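(* Let $1<p<\infty$, $q=p/(p-1)$, let $A=(a_{nk})$ be an infinite real matrix, and let $\bar{A}=(\bar a_{nk})$ be the associated matrix, $\bar a_{nk}=\sum_{j=k}^{\infty}\frac{f_{j+1}^{2}}{f_kf_{k+1}}a_{nj}$. Then: (a) If $A\in(\ell_p(\widehat F),\ell_\infty)$, then $$0\le \|L_A\|_\chi\le \limsup_{n\to\infty}\Big(\sum_{k}|\bar a_{nk}|^{q}\Big)^{1/q},$$ and $L_A$ is compact if $\lim_{n\to\infty}\big(\sum_k|\bar a_{nk}|^q\big)^{1/q}=0$. (b) If $A\in(\ell_p(\widehat F),c_0)$, then $$\|L_A\|_\chi= \limsup_{n\to\infty}\Big(\sum_{k}|\bar a_{nk}|^{q}\Big)^{1/q},$$ and $L_A$ is compact if and only if $\lim_{n\to\infty}\big(\sum_k|\bar a_{nk}|^q\big)^{1/q}=0$. (c) If $A\in(\ell_p(\widehat F),c)$, then $$\tfrac12\limsup_{n\to\infty}\Big(\sum_{k}|\bar a_{nk}-\bar\alpha_k|^{q}\Big)^{1/q}\le\|L_A\|_\chi\le \limsup_{n\to\infty}\Big(\sum_{k}|\bar a_{nk}-\bar\alpha_k|^{q}\Big)^{1/q},$$ and $L_A$ is compact if and only if $\lim_{n\to\infty}\big(\sum_k|\bar a_{nk}-\bar\alpha_k|^q\big)^{1/q}=0$, where $\bar\alpha_k=\lim_{n\to\infty}\bar a_{nk}$ for all $k\in\mathbb N$.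
   Context: $\mathbb N=\{0,1,2,\dots\}$; sums $\sum_k$ run over $k\in\mathbb N$. $\omega$ is the space of all real sequences $x=(x_k)_{k\in\mathbb N}$; $\ell_\infty$, $c$, $c_0$ are the spaces of bounded, convergent, null real sequences with the sup norm; $\ell_p$ is the usual space of real $p$-summable sequences with its usual norm. Fibonacci numbers: $f_0=f_1=1$, $f_n=f_{n-1}+f_{n-2}$ for $n\ge2$. For $x\in\omega$ the sequence $y=\widehat F x$ is given by $y_0=\frac{f_0}{f_1}x_0=x_0$ and $y_n=\frac{f_n}{f_{n+1}}x_n-\frac{f_{n+1}}{f_n}x_{n-1}$ for $n\ge1$. For $1\le p\le\infty$, $\ell_p(\widehat F)=\{x\in\omega:\widehat F x\in\ell_p\}$, a Banach space with norm $\|x\|_{\ell_p(\widehat F)}=\|\widehat Fx\|_{\ell_p}$. For sequence spaces $X,Y$, $(X,Y)$ is the set of infinite real matrices $A=(a_{nk})_{n,k\in\mathbb N}$ such that for every $x\in X$ the series $A_n(x)=\sum_k a_{nk}x_k$ converges for every $n$ and $Ax=(A_n(x))_n\in Y$. For $A\in(X,Y)$, $L_A:X\to Y$ is the linear operator $L_A(x)=Ax$ (bounded for the spaces considered here). For $A\in(\ell_p(\widehat F),Y)$ the series defining $\bar a_{nk}$ converge for all $n,k$. Hausdorff measure of noncompactness: for a bounded subset $Q$ of a metric space $Y$, $\chi(Q)$ is the infimum of all $\varepsilon>0$ such that $Q$ is covered by finitely many balls $B(x_i,r_i)$ with centres $x_i\in Y$ and radii $r_i<\varepsilon$. For a bounded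 linear operator $L:X\to Y$ between Banach spaces, $\|L\|_\chi=\chi(L(S_X))$, where $S_X$ is the unit sphere of $X$ and $\chi$ is taken in $Y$. A linear operator $L:X\to Y$ defined on all of $X$ is compact if $L(Q)$ is totally bounded for every bounded $Q\subset X$. *)

(* Defs.v *)
From HB Require Import structures.
From mathcomp Require Import all_boot all_order all_algebra.
From mathcomp Require Import all_classical all_reals all_analysis.
Set Implicit Arguments.
Unset Strict Implicit.
Unset Printing Implicit Defensive.
Import Order.TTheory GRing.Theory Num.Theory.
Import numFieldNormedType.Exports.

Local Open Scope classical_set_scope.
Local Open Scope ring_scope.

(* Indexed so that fib 0 = fib 1 = 1. *)
Fixpoint fib (n : nat) : nat :=
  match n with
  | 0 => 1
  | n1.+1 => match n1 with 0 => 1 | n2.+1 => fib n1 + fib n2 end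
  end%N.

Section Spaces.
Variable R : realType.
Implicit Types (x : R^nat) (p : R) (A : nat -> R^nat).

(* A normed sequence space is given as a linear subspace of R^nat together with its
   norm. The norm is extended-real valued and defined on all of R^nat; only its
   (finite) values on the carrier matter. *)
Record seqSpace := SeqSpace {
  carrier :> set (R^nat);
  snorm : R^nat -> \bar R }.

Definition supnorm x : \bar R := ereal_sup (range (fun k => `|x k|%:E)).

Definition lnorm p x : \bar R := 'N[counting]_(p%:E)[EFin \o x]%E.

Lemma lnormE p x : 0 < p ->
  lnorm p x = ((\sum_(k <oo) (`|(x k)%:E| `^ p)) `^ p^-1)%E.
Proof. by move=> p0; rewrite /lnorm Lnorm_counting. Qed.

Definition ell_inf := SeqSpace [set x | bounded_fun x] supnorm.
Definition cspace := SeqSpace [set x | cvgn x] supnorm.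
Definition c0space := SeqSpace [set x | x @ \oo --> (0 : R)] supnorm.
Definition ell p := SeqSpace [set x | (lnorm p x < +oo)%E] (lnorm p).

Definition Fhat x : R^nat := fun n =>
  match n with
  | 0 => (fib 0)%:R / (fib 1)%:R * x 0%N
  | m.+1 => (fib n)%:R / (fib n.+1)%:R * x n - (fib n.+1)%:R / (fib n)%:R * x m
  end.

Definition ellF p :=
  SeqSpace [set x | carrier (ell p) (Fhat x)] (fun x => snorm (ell p) (Fhat x)).

Definition mxact A x : R^nat := fun n => limn (series (fun k => A n k * x k)).

Definition matclass (X Y : set (R^nat)) : set (nat -> R^nat) :=
  [set A | forall x, X x ->
     (forall n, cvgn (series (fun k => A n k * x k))) /\ Y (mxact A x)].

Definition abar A : nat -> R^nat := fun n k =>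
  limn (fun m => \sum_(k <= j < m)
    ((fib j.+1)%:R ^+ 2 / ((fib k)%:R * (fib k.+1)%:R) * A n j)).

Definition alphabar A : R^nat := fun k => limn (fun n => abar A n k).

Definition sball (Y : seqSpace) (c : R^nat) (r : R) : set (R^nat) :=
  [set y | carrier Y y /\ (snorm Y (fun k => y k - c k)%R < r%:E)%E].

Definition sbounded (X : seqSpace) (Q : set (R^nat)) :=
  exists M : R, forall x, Q x -> (snorm X x <= M%:E)%E.

Definition usphere (X : seqSpace) : set (R^nat) :=
  [set x | carrier X x /\ snorm X x = 1%E].

(* The centres range over the whole space Y. The value is +oo when Q has no
   finite cover at all, i.e. when Q is unbounded. *)
Definition hmn (Y : seqSpace) (Q : set (R^nat)) : \bar R :=
  ereal_inf [set e%:E | e in [set e : R | 0 < e /\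
    exists (m : nat) (c : 'I_m -> R^nat) (r : 'I_m -> R),
      (forall i, carrier Y (c i) /\ 0 < r i < e) /\
      Q `<=` \bigcup_(i in [set: 'I_m]) sball Y (c i) (r i)]].

Definition op_hmn (X Y : seqSpace) (L : R^nat -> R^nat) : \bar R :=
  hmn Y (L @` usphere X).

Definition stotally_bounded (Y : seqSpace) (Q : set (R^nat)) :=
  forall e : R, 0 < e -> exists (m : nat) (c : 'I_m -> R^nat),
    (forall i, carrier Y (c i)) /\
    Q `<=` \bigcup_(i in [set: 'I_m]) sball Y (c i) e.

Definition compact_op (X Y : seqSpace) (L : R^nat -> R^nat) :=
  forall Q : set (R^nat), Q `<=` X -> sbounded X Q ->
    stotally_bounded Y (L @` Q).

End Spaces.

Arguments ell_inf {R}.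
Arguments cspace {R}.
Arguments c0space {R}.

(* Main.v *)
Require Import Defs.
From HB Require Import structures.
From mathcomp Require Import all_boot all_order all_algebra.
From mathcomp Require Import all_classical all_reals all_analysis.
From mathcomp Require Import ring lra.
Import Order.TTheory GRing.Theory Num.Theory.
Import numFieldNormedType.Exports.
Local Open Scope classical_set_scope.
Local Open Scope ring_scope.

(* With [y = Fhat x], summation by parts writes the partial sums of [(A x)_n] as
   pairings of [y] with the truncations of the [n]-th row of [abar A]; these are
   bounded in [l_q] by uniform boundedness, so that row is in [l_q] and
   [(A x)_n = sum_k (abar A n k) y_k]. The operator thus acts on [l_p] through the
   rows of [abar A], and in the convergent case it splits as [x |-> <alphabar, y>]
   times the constant sequence [1] plus the operator with rows [abar A n - alphabar].
   Upper bounds: the first [N] coordinates and the constant part range over bounded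
   subsets of a finite dimensional space, hence have finite nets, and the remaining
   coordinates are at most the tail supremum of the [l_q] norms of the rows.
   Lower bounds: the [n]-th row attains its truncated norms on finitely supported unit
   vectors; comparing the image of such a vector with the centre [c] of the ball
   containing it bounds the norm by the radius plus [|c_n|] in [c0], and by twice the
   radius plus [|c_n - lim c|] in [c]. *)

Set Implicit Arguments.
Unset Strict Implicit.

(** * Finite Hoelder inequality and its equality case *)

Section PrefixNorms.
Variable R : realType.
Implicit Types (p q : R) (m : nat) (a u x y z : R^nat).

Definition psum p m y : R := \sum_(0 <= k < m) `|y k| `^ p.
Definition pnorm p m y : R := psum p m y `^ p^-1.
(** Encodes membership in [l_p] with norm at most [K] through finite sums, so that extended reals
    enter only with [lnorm_leP]. *)
Definition lp_le p y (K : R) := forall m, pnorm p m y <= K.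

Lemma powRK p (r : R) : p != 0 -> 0 <= r -> (r `^ p) `^ p^-1 = r.
Proof. by move=> p0 r0; rewrite -powRrM mulfV// powRr1. Qed.

Lemma powRVK p (r : R) : p != 0 -> 0 <= r -> (r `^ p^-1) `^ p = r.
Proof. by move=> p0 r0; rewrite -powRrM mulVf// powRr1. Qed.

Lemma powRV (r s : R) : 0 <= r -> r^-1 `^ s = (r `^ s)^-1.
Proof. by move=> r0; rewrite -powR_inv1// powRAC powR_inv1// powR_ge0. Qed.

Lemma psum_ge0 p m y : 0 <= psum p m y.
Proof. by apply: sumr_ge0 => k _; exact: powR_ge0. Qed.

Lemma pnorm_ge0 p m y : 0 <= pnorm p m y.
Proof. exact: powR_ge0. Qed.

Lemma psumS p m y : psum p m.+1 y = psum p m y + `|y m| `^ p.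
Proof. by rewrite /psum big_nat_recr. Qed.

Lemma pnorm_powR p m y : p != 0 -> pnorm p m y `^ p = psum p m y.
Proof. by move=> p0; rewrite powRVK// psum_ge0. Qed.

Lemma psum_le p m n y : (m <= n)%N -> psum p m y <= psum p n y.
Proof.
move=> mn; rewrite /psum [leRHS](big_cat_nat (n := m))//= lerDl.
by apply: sumr_ge0 => k _; exact: powR_ge0.
Qed.

Lemma ler_pnorm p m n y : 0 < p -> (m <= n)%N -> pnorm p m y <= pnorm p n y.
Proof.
move=> p0 mn; apply: ge0_ler_powR; rewrite ?nnegrE ?psum_ge0 ?psum_le//.
by rewrite invr_ge0 ltW.
Qed.

Lemma eq_pnorm p m y z : (forall k, (k < m)%N -> `|y k| = `|z k|) ->
  pnorm p m y = pnorm p m z.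
Proof.
move=> yz; rewrite /pnorm /psum; congr (_ `^ _).
by apply: eq_big_nat => k /andP[_ km]; rewrite yz.
Qed.

Lemma pnormZ p m c y : 0 < p ->
  pnorm p m (fun k => c * y k) = `|c| * pnorm p m y.
Proof.
move=> p0; rewrite -(@powRK p `|c|) ?gt_eqF//.
rewrite /pnorm -powRM ?powR_ge0 ?psum_ge0//; congr (_ `^ _).
rewrite /psum big_distrr /=; apply: eq_bigr => k _.
by rewrite normrM powRM.
Qed.

Lemma ler_norm_pnorm p m y k : 0 < p -> (k < m)%N -> `|y k| <= pnorm p m y.
Proof.
move=> p0 km; rewrite -[leLHS](@powRK p) ?gt_eqF//.
apply: ge0_ler_powR; rewrite ?nnegrE ?psum_ge0 ?powR_ge0 ?invr_ge0 ?(ltW p0)//.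
apply: le_trans (psum_le p y km).
by rewrite psumS lerDr psum_ge0.
Qed.

Lemma lp_le_ge0 p y K : lp_le p y K -> 0 <= K.
Proof. by move=> /(_ 0%N); apply: le_trans; exact: pnorm_ge0. Qed.

Lemma lp_le0 p : 0 < p -> lp_le p (fun=> 0) 0.
Proof.
move=> p0 m; rewrite /pnorm /psum big1 ?powR0 ?invr_neq0 ?gt_eqF//.
by move=> k _; rewrite normr0 powR0 ?gt_eqF.
Qed.

Lemma le_lp_le p y K L : K <= L -> lp_le p y K -> lp_le p y L.
Proof. by move=> KL yK m; exact: le_trans (yK m) KL. Qed.

Lemma lp_leZ p y c K : 0 < p -> lp_le p y K ->
  lp_le p (fun k => c * y k) (`|c| * K).
Proof. by move=> p0 yK m; rewrite pnormZ// ler_wpM2l. Qed.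

Lemma hoelder_pnorm p q m a y : 0 < p -> 0 < q -> p^-1 + q^-1 = 1 ->
  \sum_(0 <= k < m) `|a k * y k| <= pnorm q m a * pnorm p m y.
Proof.
move=> p0 q0 pq.
have [a0|a0] := leP (pnorm q m a) 0.
  rewrite big_nat big1 ?mulr_ge0 ?pnorm_ge0// => k /andP[_ km].
  have := le_trans (ler_norm_pnorm a q0 km) a0.
  by rewrite normr_le0 => /eqP->; rewrite mul0r normr0.
have [y0|y0] := leP (pnorm p m y) 0.
  rewrite big_nat big1 ?mulr_ge0 ?pnorm_ge0// => k /andP[_ km].
  have := le_trans (ler_norm_pnorm y p0 km) y0.
  by rewrite normr_le0 => /eqP->; rewrite mulr0 normr0.
move: (pnorm_powR m a (lt0r_neq0 q0)) (pnorm_powR m y (lt0r_neq0 p0)).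
move: (pnorm q m a) (pnorm p m y) a0 y0 => al be a0 y0 alE beE.
(* Young's inequality for the normalised terms [|a k| / al] and [|y k| / be]; summed over [k], the
   bracket gives [q^-1 + p^-1 = 1]. *)
have key k : `|a k * y k| <= al * be *
    (`|a k| `^ q * ((al `^ q)^-1 / q) + `|y k| `^ p * ((be `^ p)^-1 / p)).
  have -> : `|a k * y k| = al * be * ((`|a k| / al) * (`|y k| / be)).
    by rewrite normrM mulrACA (mulrC al) (mulrC be) !divfK ?gt_eqF.
  rewrite ler_pM2l ?mulr_gt0//.
  apply: (le_trans (@conjugate_powR R _ _ q p _ _ q0 p0 _)).
  - by rewrite divr_ge0// ltW.
  - by rewrite divr_ge0// ltW.
  - by rewrite addrC.
  rewrite !powRM ?invr_ge0 ?(ltW a0) ?(ltW y0)//.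
  by rewrite !powRV ?(ltW a0) ?(ltW y0)// !mulrA.
apply: (le_trans (ler_sum _ (fun k _ => key k))).
rewrite -big_distrr /= big_split /= -!big_distrl /=.
rewrite -/(psum q m a) -/(psum p m y) -alE -beE !mulrA !mulfV ?gt_eqF ?powR_gt0// !mul1r.
by rewrite (addrC q^-1) pq mulr1.
Qed.

Lemma conj_gt1 p q : 0 < p -> 0 < q -> p^-1 + q^-1 = 1 -> 1 < q.
Proof.
move=> p0 q0 pq; rewrite -[q]invrK invf_gt1 ?invr_gt0//.
by rewrite -pq ltrDr invr_gt0.
Qed.

Lemma conj_mul p q : 0 < p -> 0 < q -> p^-1 + q^-1 = 1 -> (q - 1) * p = q.
Proof.
move=> p0 q0 pq; have : p * q * (p^-1 + q^-1) = p * q by rewrite pq mulr1.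
rewrite mulrDr -[p * q / q]mulrA mulfV ?gt_eqF// mulrAC mulfV ?gt_eqF//.
by rewrite mul1r mulr1 mulrBl mul1r (mulrC q p) => <-; rewrite addrK.
Qed.

(** The extremal vector is [sg (a k) |a k|^(q-1) / al^(q-1)] with [al = pnorm q m a]: since
    [(q-1) p = q], its [p]-norm is 1 and its pairing with [a] is [al^q / al^(q-1)]. *)
Lemma pnorm_dual p q m a : 0 < p -> 0 < q -> p^-1 + q^-1 = 1 -> (0 < m)%N ->
  exists u, [/\ forall k, (m <= k)%N -> u k = 0, pnorm p m u = 1 &
    \sum_(0 <= k < m) a k * u k = pnorm q m a].
Proof.
move=> p0 q0 pq m0.
have [a0|a0] := leP (pnorm q m a) 0.
  (* When [a] vanishes below [m] any unit vector will do; this one is supported below [m] because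
     [0 < m]. *)
  exists (fun k => (k == 0%N)%:R); split.
  - by case => // m0'; move: m0; rewrite ltnNge m0'.
  - rewrite /pnorm /psum; case: m m0 {a0} => // m _.
    rewrite big_nat_recl//= normr1 powR1 big1 ?addr0 ?powR1//.
    by move=> i _; rewrite normr0 powR0 ?gt_eqF.
  - have z k : (k < m)%N -> a k = 0.
      move=> km; have := le_trans (ler_norm_pnorm a q0 km) a0.
      by rewrite normr_le0 => /eqP.
    rewrite big_nat big1; last by move=> k /andP[_ /z ->]; rewrite mul0r.
    by apply/eqP; rewrite eq_le a0 pnorm_ge0.
move: (pnorm_powR m a (lt0r_neq0 q0)); move: (pnorm q m a) a0 => al a0 alE.
have q1 := conj_gt1 p0 q0 pq.
exists (fun k => if (k < m)%N then Num.sg (a k) * (`|a k| `^ (q - 1) / al `^ (q - 1)) else 0).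
have alq : al `^ q != 0 by rewrite gt_eqF// powR_gt0.
have alq1 : al `^ (q - 1) != 0 by rewrite gt_eqF// powR_gt0.
split.
- by move=> k; rewrite leqNgt => /negbTE ->.
- rewrite /pnorm (_ : psum _ _ _ = 1) ?powR1//.
  rewrite /psum (eq_big_nat _ _ (F2 := fun k => `|a k| `^ q * (al `^ q)^-1)).
    by rewrite -big_distrl/= -/(psum q m a) -alE mulfV.
  move=> k /andP[_ km]; rewrite km normrM.
  have [->|ak0] := eqVneq (a k) 0.
    by rewrite sgr0 !normr0 mul0r !powR0 ?gt_eqF// mul0r.
  rewrite normr_sg ak0 mul1r ger0_norm ?divr_ge0 ?powR_ge0//.
  rewrite powRM ?invr_ge0 ?powR_ge0// -powRrM conj_mul//; congr (_ * _).
  by rewrite powRV ?powR_ge0// -powRrM conj_mul.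
- rewrite (eq_big_nat _ _ (F2 := fun k => `|a k| `^ q * (al `^ (q - 1))^-1)).
    rewrite -big_distrl/= -/(psum q m a) -alE.
    by rewrite -(mulr_powRB1 _ q0) ?(ltW a0)// mulfK.
  move=> k /andP[_ km]; rewrite km 2!mulrA; congr (_ / _).
  by rewrite [a k * _]mulrC -normrEsg mulr_powRB1.
Qed.

End PrefixNorms.

(** * The pairing of [l_q] and [l_p] *)

Section Pairing.
Variables (R : realType) (p q : R).
Hypotheses (p0 : 0 < p) (q0 : 0 < q) (pq : p^-1 + q^-1 = 1).
Implicit Types (m : nat) (a b u x y z : R^nat) (K L M : R).

Lemma cvg_prefix_sum (z : nat -> R^nat) y u m :
  (forall k, z ^~ k @ \oo --> y k) ->
  (fun j => \sum_(0 <= k < m) z j k * u k) @ \oo --> \sum_(0 <= k < m) y k * u k.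
Proof.
move=> zy; elim: m => [|m IH].
  by rewrite big_geq//; under eq_fun do rewrite big_geq//; exact: cvg_cst.
rewrite big_nat_recr//=; under eq_fun do rewrite big_nat_recr//=.
by apply: cvgD => //; apply: cvgM; [exact: zy|exact: cvg_cst].
Qed.

(** Converse of Hoelder, from the extremal vector of [pnorm_dual] with the exponents exchanged. The
    prefix is lengthened to [m.+1] because that vector needs a nonempty prefix. *)
Lemma le_lp_dual y K :
  (forall m u, (forall k, (m <= k)%N -> u k = 0) -> pnorm q m u = 1 ->
     \sum_(0 <= k < m) y k * u k <= K) -> lp_le p y K.
Proof.
move=> H m; apply: le_trans (ler_pnorm y p0 (leqnSn m)) _.
have qp : q^-1 + p^-1 = 1 by rewrite addrC.
by have [u [us u1 <-]] := pnorm_dual y q0 p0 qp (ltn0Sn m); exact: H.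
Qed.

Lemma norm_sum_pnorm m a y :
  `|\sum_(0 <= k < m) a k * y k| <= pnorm q m a * pnorm p m y.
Proof. exact: le_trans (ler_norm_sum _ _ _) (hoelder_pnorm m a y p0 q0 pq). Qed.

(** Fatou's property by duality: a finite pairing with a fixed [u] is continuous for coordinatewise
    convergence. *)
Lemma lp_le_cvg (z : nat -> R^nat) y K :
  (forall k, z ^~ k @ \oo --> y k) -> (\forall j \near \oo, lp_le p (z j) K) ->
  lp_le p y K.
Proof.
move=> zy zK; apply: le_lp_dual => m u us u1.
apply: (cvgr_to_le (@cvg_prefix_sum z y u m zy)).
near=> j; under eq_bigr do rewrite mulrC.
apply: le_trans (ler_norm _) _; apply: le_trans (norm_sum_pnorm _ _ _) _.
rewrite u1 mul1r; suff : lp_le p (z j) K by exact.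
by near: j.
Unshelve. all: by end_near. Qed.

(** Minkowski's inequality by duality: each unit vector [u] pairs with [y] to at most [K] and with
    [z] to at most [L]. *)
Lemma lp_leD y z K L : lp_le p y K -> lp_le p z L ->
  lp_le p (fun k => y k + z k) (K + L).
Proof.
move=> yK zL; apply: le_lp_dual => m u us u1.
rewrite (eq_bigr (fun k => u k * y k + u k * z k)); last first.
  by move=> k _; rewrite mulrC mulrDr.
rewrite big_split /=; apply: lerD.
- apply: le_trans (ler_norm _) _; apply: le_trans (norm_sum_pnorm _ _ _) _.
  by rewrite u1 mul1r.
- apply: le_trans (ler_norm _) _; apply: le_trans (norm_sum_pnorm _ _ _) _.
  by rewrite u1 mul1r.
Qed.

Lemma lp_leB y z K L : lp_le p y K -> lp_le p z L ->
  lp_le p (fun k => y k - z k) (K + L).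
Proof.
move=> yK zL; have zN : lp_le p (fun k => -1 * z k) L.
  by have := lp_leZ (-1) p0 zL; rewrite normrN1 mul1r.
rewrite (_ : (fun k => y k - z k) = (fun k => y k + -1 * z k)); first exact: lp_leD.
by apply/funext => k; rewrite mulN1r.
Qed.

End Pairing.

(** * The infinite pairing and its continuity *)

Section Dot.
Variables (R : realType) (p q : R).
Hypotheses (p0 : 0 < p) (q0 : 0 < q) (pq : p^-1 + q^-1 = 1).
Implicit Types (m : nat) (a b u x y z : R^nat) (K L M : R).

Lemma lp_le_finsupp m y : (forall k, (m <= k)%N -> y k = 0) ->
  lp_le p y (pnorm p m y).
Proof.
move=> ys n; have [nm|/ltnW mn] := leqP n m; first exact: ler_pnorm.
rewrite /pnorm (_ : psum p n y = psum p m y)//.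
rewrite /psum [LHS](big_cat_nat (n := m))//= [X in _ + X]big_nat [X in _ + X]big1 ?addr0//.
by move=> k /andP[mk _]; rewrite ys// normr0 powR0 ?gt_eqF.
Qed.

Definition dot a y : R := limn (series (fun k => a k * y k)).

Lemma dot_finsupp m a y : (forall k, (m <= k)%N -> y k = 0) ->
  series (fun k => a k * y k) @ \oo --> \sum_(0 <= k < m) a k * y k.
Proof.
move=> ys; apply: cvg_near_cst; near=> n.
rewrite /series /= (big_cat_nat (n := m))//=; last by near: n; exact: nbhs_infty_ge.
rewrite [X in _ + X]big_nat [X in _ + X]big1 ?addr0//.
by move=> k /andP[mk _]; rewrite ys// mulr0.
Unshelve. all: by end_near. Qed.

Lemma dot_finsuppE m a y : (forall k, (m <= k)%N -> y k = 0) ->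
  dot a y = \sum_(0 <= k < m) a k * y k.
Proof. by move=> ys; apply: cvg_lim => //; exact: dot_finsupp. Qed.

Lemma dot_delta a k : dot a (fun j => (j == k)%:R) = a k.
Proof.
rewrite (@dot_finsuppE k.+1) => [|j kj]; last by rewrite gtn_eqF.
rewrite big_nat_recr//= eqxx mulr1 big_nat big1 ?add0r// => j /andP[_ jk].
by rewrite ltn_eqF// mulr0.
Qed.

Lemma lp_le_delta k : exists M, lp_le p (fun j => (j == k)%:R) M.
Proof.
exists (pnorm p k.+1 (fun j => (j == k)%:R)).
by apply: lp_le_finsupp => j kj; rewrite gtn_eqF.
Qed.

Lemma is_cvg_dot a y K M : lp_le q a K -> lp_le p y M ->
  cvgn (series (fun k => a k * y k)).
Proof.
move=> aK yM; apply: normed_cvg; apply: nondecreasing_is_cvgn.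
  by apply: nondecreasing_series => k _ _; exact: normr_ge0.
exists (K * M) => _ [n _ <-]; apply: le_trans (hoelder_pnorm n a y p0 q0 pq) _.
by apply: ler_pM; rewrite ?pnorm_ge0.
Qed.

Lemma norm_dot_le a y K M : lp_le q a K -> lp_le p y M -> `|dot a y| <= K * M.
Proof.
move=> aK yM; have c := is_cvg_dot aK yM.
have c' : `|series (fun k => a k * y k) n| @[n --> \oo] --> `|dot a y|.
  exact: cvg_norm.
apply: (cvgr_to_le c').
apply: nearW => n; rewrite /series /=.
apply: le_trans (norm_sum_pnorm p0 q0 pq _ _ _) _.
by apply: ler_pM; rewrite ?pnorm_ge0.
Qed.

Lemma dotDr a y z K L M : lp_le q a K -> lp_le p y L -> lp_le p z M ->
  dot a (fun k => y k + z k) = dot a y + dot a z.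
Proof.
move=> aK yL zM; rewrite /dot -lim_seriesD; [|exact: is_cvg_dot yL..|exact: is_cvg_dot zM].
by congr (limn (series _)); apply/funext => k; rewrite mulrDr.
Qed.

Lemma dotBl a b y K L M : lp_le q a K -> lp_le q b L -> lp_le p y M ->
  dot (fun k => a k - b k) y = dot a y - dot b y.
Proof.
move=> aK bL yM; rewrite /dot -lim_seriesB; [|exact: is_cvg_dot yM..].
by congr (limn (series _)); apply/funext => k; rewrite mulrBl.
Qed.

Lemma dotZr a y c K M : lp_le q a K -> lp_le p y M ->
  dot a (fun k => c * y k) = c * dot a y.
Proof.
move=> aK yM; apply: cvg_lim => //.
rewrite (_ : series _ = fun n => c * series (fun k => a k * y k) n); last first.
  by apply/funext => n; rewrite /series /= mulr_sumr; apply: eq_bigr => k _; rewrite mulrCA.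
by apply: cvgM; [exact: cvg_cst|exact: is_cvg_dot yM].
Qed.

(** The sums of [p]-th powers increase to a finite limit, so from some [N] on the remainder is at
    most [e^p]. *)
Lemma lp_le_tail y M (e : R) : lp_le p y M -> 0 < e ->
  exists N, lp_le p (fun k => if (k < N)%N then 0 else y k) e.
Proof.
move=> yM e0.
have nd : nondecreasing_seq (fun m => psum p m y) by move=> m n; exact: psum_le.
have c : cvgn (fun m => psum p m y).
  apply: nondecreasing_is_cvgn => //; exists (M `^ p) => _ [m _ <-].
  rewrite -pnorm_powR ?gt_eqF//; apply: ge0_ler_powR; rewrite ?nnegrE ?(ltW p0)//.
    exact: pnorm_ge0.
  exact: lp_le_ge0 yM.
have ep : 0 < e `^ p by rewrite powR_gt0.
have /cvgrPdist_le /(_ _ ep) [N _ NP] := c.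
exists N => m; have [mN|Nm] := leqP m N.
  rewrite /pnorm /psum big_nat big1 ?powR0 ?(ltW e0)// ?invr_neq0 ?gt_eqF//.
  by move=> k /andP[_ km]; rewrite (leq_trans km mN) normr0 powR0 ?gt_eqF.
rewrite -[leRHS](@powRK _ p) ?gt_eqF ?(ltW e0)//.
apply: ge0_ler_powR; rewrite ?nnegrE ?psum_ge0 ?powR_ge0 ?invr_ge0 ?(ltW p0)//.
have -> : psum p m (fun k => if (k < N)%N then 0 else y k) = psum p m y - psum p N y.
  rewrite /psum [in RHS](big_cat_nat (n := N) (p := m))//= ?(ltnW Nm)// addrAC subrr add0r.
  rewrite [LHS](big_cat_nat (n := N))//= ?(ltnW Nm)// big_nat big1 ?add0r.
    by apply: eq_big_nat => k /andP[Nk _]; rewrite ltnNge Nk.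
  by move=> k /andP[_ ->]; rewrite normr0 powR0 ?gt_eqF.
apply: le_trans (NP N (leqnn N)); apply: le_trans (ler_norm _).
by rewrite lerB//; exact: nondecreasing_cvgn_le.
Qed.

(** Bounded coordinatewise convergence implies weak convergence: [y] is cut into a finite prefix,
    where coordinatewise convergence suffices, and a tail of small norm. *)
Lemma cvg_dot (z : nat -> R^nat) a y K M : (forall k, z ^~ k @ \oo --> a k) ->
  (forall j, lp_le q (z j) K) -> lp_le q a K -> lp_le p y M ->
  (fun j => dot (z j) y) @ \oo --> dot a y.
Proof.
move=> za zK aK yM; apply/cvgrPdist_le => e e0.
have K0 := lp_le_ge0 aK.
(* [a - z j] has norm at most [K + K], so this tail contributes at most [e / 2]; the added 1 keeps
   the denominator positive when [K = 0]. *)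
have [N yN] : exists N, lp_le p (fun k => if (k < N)%N then 0 else y k) (e / 2 / (K + K + 1)).
  by apply: lp_le_tail yM _; rewrite !divr_gt0//; lra.
pose y1 k := if (k < N)%N then y k else 0.
have y1s k : (N <= k)%N -> y1 k = 0 by rewrite /y1 leqNgt => /negbTE ->.
have S : (fun j => \sum_(0 <= k < N) (a k - z j k) * y1 k) @ \oo --> (0 : R).
  rewrite -[X in _ --> X](_ : \sum_(0 <= k < N) (a k - a k) * y1 k = 0); last first.
    by rewrite big1// => k _; rewrite subrr mul0r.
  apply: (@cvg_prefix_sum _ (fun j k => a k - z j k) (fun k => a k - a k)) => k.
  by apply: cvgB; [exact: cvg_cst|exact: za].
have e2 : 0 < e / 2 by lra.
have /cvgrPdist_le /(_ _ e2) := S; apply: filterS => j.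
rewrite sub0r normrN => Sj.
have qp : q^-1 + p^-1 = 1 by rewrite addrC.
have azK : lp_le q (fun k => a k - z j k) (K + K) by apply: (lp_leB q0 p0 qp aK); exact: zK.
have yE : y = (fun k => y1 k + (if (k < N)%N then 0 else y k)).
  by apply/funext => k; rewrite /y1; case: ifP; rewrite ?addr0 ?add0r.
rewrite -(dotBl aK (zK j) yM) [in dot _ y]yE (dotDr azK (lp_le_finsupp y1s) yN).
apply: le_trans (ler_normD _ _) _; rewrite [leRHS](splitr e) (dot_finsuppE _ y1s).
apply: lerD => //; apply: le_trans (norm_dot_le azK yN) _.
rewrite mulrA ler_pdivrMr; last lra.
by rewrite mulrC ler_wpM2l//; lra.
Qed.

End Dot.

(** * Uniform boundedness by a gliding hump *)

Section UniformBoundedness.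
Variables (R : realType) (p q : R).
Hypotheses (p0 : 0 < p) (q0 : 0 < q) (pq : p^-1 + q^-1 = 1).
Implicit Types (m : nat) (a b u x y z : R^nat) (K L M : R).

(** [L] is the supremum of the prefix norms, that is, the norm of [a]. Any factor below 1 is reached
    by a prefix; [9 / 10] leaves room in [hump_unbounded]. *)
Lemma lp_le_tight a K : lp_le q a K ->
  exists L m, lp_le q a L /\ 9 / 10 * L <= pnorm q m a.
Proof.
move=> aK; pose E := range (pnorm q ^~ a).
have hs : has_sup E.
  split; first by exists (pnorm q 0 a), 0%N.
  by exists K => _ [m _ <-]; exact: aK.
have aL : lp_le q a (sup E) by move=> m; apply: sup_upper_bound => //; exists m.
exists (sup E).
have [L0|L0] := leP (sup E) 0.
  exists 0%N; split => //; apply: le_trans (pnorm_ge0 _ _ _).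
  by rewrite mulr_ge0_le0//; lra.
have e0 : 0 < sup E / 10 by rewrite divr_gt0.
have [_ [m _ <-] h] := sup_adherent e0 hs.
by exists m; split=> //; lra.
Qed.

Lemma norming_finsupp a K : lp_le q a K -> exists L u,
  [/\ lp_le q a L, lp_le p u 1 & 9 / 10 * L <= dot a u].
Proof.
move=> aK; have [L [m [aL mL]]] := lp_le_tight aK.
have [u [us u1 au]] := pnorm_dual a p0 q0 pq (ltn0Sn m).
exists L, u; split => //; first by rewrite -u1; exact: lp_le_finsupp.
by rewrite (dot_finsuppE _ us) au; apply: le_trans mL _; exact: ler_pnorm.
Qed.

(* Of the two points [x + w] and [x - w], at least one has [a j]-value of modulus at
   least that of [w]; the next iterate is such a point. *)
Fixpoint hump (a u : nat -> R^nat) (i : nat) : R^nat :=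
  if i is j.+1 then
    let z (s : R) := (fun k => hump a u j k + s * 3^-1 ^+ j * u j k) in
    if 3^-1 ^+ j * dot (a j) (u j) <= `|dot (a j) (z 1)| then z 1 else z (-1)
  else (fun=> 0).

Section Hump.
Variables (a u : nat -> R^nat) (L : R^nat).
Hypothesis uP : forall i, lp_le p (u i) 1.
Hypothesis aP : forall i, lp_le q (a i) (L i).

Lemma ge0_third i : 0 <= 3^-1 ^+ i :> R.
Proof. by rewrite exprn_ge0// invr_ge0. Qed.

Lemma hump_sg i : exists2 s : R, `|s| = 1 &
  hump a u i.+1 = (fun k => hump a u i k + s * 3^-1 ^+ i * u i k).
Proof.
rewrite /=; case: ifP => _; [exists 1|exists (-1)] => //.
  exact: normr1.
exact: normrN1.
Qed.

Lemma lp_le_scaled_hump i (s : R) : `|s| = 1 ->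
  lp_le p (fun k => s * 3^-1 ^+ i * u i k) (3^-1 ^+ i).
Proof.
move=> s1; have := lp_leZ (s * 3^-1 ^+ i) p0 (uP i).
by rewrite normrM s1 mul1r mulr1 ger0_norm// ge0_third.
Qed.

Lemma lp_le_hump i : exists M, lp_le p (hump a u i) M.
Proof.
elim: i => [|i [M xM]].
  by exists 0; exact: lp_le0.
have [s s1 ->] := hump_sg i; exists (M + 3^-1 ^+ i).
exact (lp_leD p0 q0 pq xM (lp_le_scaled_hump i s1)).
Qed.

Lemma hump_dot i :
  3^-1 ^+ i * dot (a i) (u i) <= `|dot (a i) (hump a u i.+1)|.
Proof.
rewrite /=; case: ifPn => //; rewrite -ltNge.
have [M xM] := lp_le_hump i.
have E s : `|s| = 1 -> dot (a i) (fun k => hump a u i k + s * 3^-1 ^+ i * u i k) =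
    dot (a i) (hump a u i) + s * (3^-1 ^+ i * dot (a i) (u i)).
  move=> s1; rewrite (dotDr p0 q0 pq (aP i) xM (lp_le_scaled_hump i s1)).
  by rewrite (dotZr p0 q0 pq _ (aP i) (uP i)) mulrA.
rewrite !E ?normr1 ?normrN1// mul1r mulN1r.
move: (dot _ _) (_ * _) => X W; rewrite ltr_norml => /andP[h1 h2].
(* Here [|X + W| < W] forces [X < 0 < W], whence [|X - W| = W - X >= W]. *)
rewrite ler0_norm; lra.
Qed.

(** The bound is the geometric sum of the step sizes [3^-i, ..., 3^-(i+j-1)]. *)
Lemma lp_le_hump_sub i j :
  lp_le p (fun k => hump a u (i + j) k - hump a u i k)
    (3 / 2 * 3^-1 ^+ i * (1 - 3^-1 ^+ j)).
Proof.
elim: j => [|j IH].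
  rewrite addn0 expr0 subrr mulr0 => m.
  by rewrite (eq_pnorm _ (z := fun=> 0)) ?lp_le0// => k _; rewrite subrr.
rewrite addnS; have [s s1 ->] := hump_sg (i + j).
have := lp_leD p0 q0 pq IH (lp_le_scaled_hump (i + j) s1).
rewrite (_ : 3 / 2 * 3^-1 ^+ i * (1 - 3^-1 ^+ j) + 3^-1 ^+ (i + j) =
   3 / 2 * 3^-1 ^+ i * (1 - 3^-1 ^+ j.+1) :> R); last first.
  by rewrite exprD exprS; field.
by move=> H m; rewrite (eq_pnorm _ (z := fun k => hump a u (i + j) k - hump a u i k +
  s * 3^-1 ^+ (i + j) * u (i + j)%N k))// => k _; rewrite addrAC.
Qed.

Lemma lp_le_hump_sub_le i j : (i <= j)%N ->
  lp_le p (fun k => hump a u j k - hump a u i k) (3 / 2 * 3^-1 ^+ i).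
Proof.
move=> ij; have := lp_le_hump_sub i (j - i); rewrite subnKC//.
by apply: le_lp_le; rewrite ler_piMr ?mulr_ge0 ?ge0_third//.
Qed.

Lemma cvg_hump k : cvgn (fun i => hump a u i k).
Proof.
apply: cauchy_cvg; apply: cauchy_exP => e e0.
have z : (fun i => 3 / 2 * 3^-1 ^+ i : R) @ \oo --> (0 : R).
  rewrite -[X in _ --> X](mulr0 (3 / 2)); apply: cvgM; first exact: cvg_cst.
  by apply: cvg_expr; rewrite ger0_norm ?invr_ge0//; lra.
have /cvgrPdist_lt /(_ _ e0) [i _ /(_ i (leqnn i))] := z.
rewrite /= sub0r normrN ger0_norm ?mulr_ge0 ?ge0_third//.
move=> ie; exists (hump a u i k); exists i => // j /= ij.
rewrite /ball /= distrC; apply: le_lt_trans ie.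
apply: le_trans (lp_le_hump_sub_le ij k.+1).
exact (ler_norm_pnorm (fun k => hump a u j k - hump a u i k) p0 (ltnSn k)).
Qed.

(** Step [i] secures the value [9/10 * 3^-i * L i] at [a i]; all later steps together move the point
    by at most [3/2 * 3^-(i+1) = 1/2 * 3^-i], so at least [9/10 - 1/2 = 2/5] of [3^-i * L i]
    survives in the limit. *)
Lemma hump_unbounded : (forall i, 9 / 10 * L i <= dot (a i) (u i)) ->
  exists2 x, (exists M, lp_le p x M) &
    forall i, 2 / 5 * 3^-1 ^+ i * L i <= `|dot (a i) x|.
Proof.
move=> Lau; pose x k := limn (fun i => hump a u i k).
have xi i : lp_le p (fun k => x k - hump a u i k) (3 / 2 * 3^-1 ^+ i).
  apply: (lp_le_cvg p0 q0 pq (z := fun j k => hump a u j k - hump a u i k)).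
    by move=> k; apply: cvgB; [exact: cvg_hump|exact: cvg_cst].
  by exists i => // j /= ij; exact: lp_le_hump_sub_le.
exists x.
  (* The iteration starts at 0, so the distance from the start bounds the norm of [x]. *)
  exists (3 / 2 * 3^-1 ^+ 0) => m; rewrite (@eq_pnorm _ _ _ _ (fun k => x k - hump a u 0 k)).
    exact: xi.
  by move=> k _; rewrite subr0.
move=> i; have [M hM] := lp_le_hump i.+1.
have -> : dot (a i) x = dot (a i) (fun k => hump a u i.+1 k + (x k - hump a u i.+1 k)).
  by congr (dot _ _); apply/funext => k; rewrite addrC subrK.
rewrite (dotDr p0 q0 pq (aP i) hM (xi i.+1)).
have h1 := hump_dot i; have h2 := norm_dot_le p0 q0 pq (aP i) (xi i.+1).
apply: le_trans (lerB_normD _ _).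
apply: le_trans (lerB h1 h2).
have := ler_wpM2l (ge0_third i) (Lau i); rewrite exprS; lra.
Qed.

End Hump.

Lemma lp_uniform_boundedness (t : nat -> R^nat) :
  (forall n, exists K, lp_le q (t n) K) ->
  (forall y M, lp_le p y M -> exists C, forall n, `|dot (t n) y| <= C) ->
  exists K, forall n, lp_le q (t n) K.
Proof.
move=> tq tb; apply: contrapT => nb.
(* If no uniform bound exists, some row has norm at least [i * 3^i]; the factor [3^i] offsets the
   hump size [3^-i] and leaves values of order [i] at the single point [x]. *)
have H (i : nat) : exists v : (R^nat * R^nat) * R, [/\ exists n, v.1.1 = t n,
    i%:R * 3 ^+ i <= v.2, lp_le q v.1.1 v.2, lp_le p v.1.2 1 &
    9 / 10 * v.2 <= dot v.1.1 v.1.2].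
  have [n ntn] : exists n, ~ lp_le q (t n) (i%:R * 3 ^+ i).
    apply: contrapT => h; apply: nb; exists (i%:R * 3 ^+ i) => n.
    by apply: contrapT => h'; apply: h; exists n.
  have [K tK] := tq n; have [L [u [tL u1 Lu]]] := norming_finsupp tK.
  exists (t n, u, L); split => //=; first by exists n.
  by rewrite leNgt; apply/negP => /ltW LL; apply: ntn; exact: le_lp_le tL.
have [v vP] := choice H.
have [x [M xM] xb] : exists2 x, (exists M, lp_le p x M) &
    forall i, 2 / 5 * 3^-1 ^+ i * (v i).2 <= `|dot (v i).1.1 x|.
  by apply: (@hump_unbounded (fun i => (v i).1.1) (fun i => (v i).1.2) (fun i => (v i).2));
    move=> i; have [] := vP i.
have [C CP] := tb x M xM.
have {}xb i : 2 / 5 * i%:R <= C.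
  have [[n vn] Li _ _ _] := vP i; have := xb i; rewrite vn.
  have h : i%:R <= 3^-1 ^+ i * (v i).2.
    by rewrite exprVn mulrC ler_pdivlMr// exprn_gt0.
  by have := CP n; lra.
have C0 : 0 <= C by apply: le_trans (CP 0%N).
have := xb (Num.bound (5 / 2 * C)).
have := archi_boundP (_ : 0 <= 5 / 2 * C); rewrite mulr_ge0//.
by move=> /(_ isT); lra.
Qed.

End UniformBoundedness.

(** * The Fibonacci matrix *)

Section FibonacciMatrix.
Variable R : realType.
Implicit Types (a x y : R^nat) (m n k j : nat).

Lemma fib_gt0 n : (0 < fib n)%N.
Proof.
suff : ((0 < fib n) && (0 < fib n.+1))%N by case/andP.
by elim: n => // n /andP[h1 h2]; rewrite h2 /= addn_gt0 h2.
Qed.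

Lemma fibr_neq0 n : (fib n)%:R != 0 :> R.
Proof. by rewrite pnatr_eq0 -lt0n fib_gt0. Qed.

(** For [k <= j], the entries of the triangular inverse of [Fhat]; they are also the weights in
    [abar]. *)
Definition fibw j k : R := (fib j.+1)%:R ^+ 2 / ((fib k)%:R * (fib k.+1)%:R).

Definition Finv y : R^nat := fun n => \sum_(0 <= k < n.+1) fibw n k * y k.

(** Solves the two-term relation defining [Fhat] for its leading entry; both inverse identities
    reduce to this recursion. *)
Lemma FinvS y n : Finv y n.+1 =
  ((fib n.+2)%:R / (fib n.+1)%:R) ^+ 2 * Finv y n +
  (fib n.+2)%:R / (fib n.+1)%:R * y n.+1.
Proof.
rewrite /Finv big_nat_recr // mulr_sumr; congr (_ + _); last first.
  rewrite /fibw; congr (_ * _).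
  move: (fibr_neq0 n.+1) (fibr_neq0 n.+2); move: (fib n.+1) (fib n.+2) => u v.
  by move: u%:R v%:R => {}u {}v u0 v0; field; rewrite u0 v0.
apply: eq_bigr => k _; rewrite mulrA; congr (_ * _); rewrite /fibw.
move: (fibr_neq0 n.+1) (fibr_neq0 k) (fibr_neq0 k.+1).
move: (fib n.+1) (fib n.+2) (fib k) (fib k.+1) => u v s t.
move: u%:R v%:R s%:R t%:R => {}u {}v {}s {}t u0 s0 t0.
by field; rewrite u0 s0 t0.
Qed.

Lemma Finv0 y : Finv y 0 = y 0%N.
Proof. by rewrite /Finv big_nat1 /fibw /= expr1n mulr1 divr1 mul1r. Qed.

Lemma FinvK y : Fhat (Finv y) = y.
Proof.
apply/funext => -[|n]; rewrite /Fhat ?Finv0 ?divr1 ?mul1r//.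
rewrite FinvS.
move: (fibr_neq0 n.+1) (fibr_neq0 n.+2); move: (fib n.+1) (fib n.+2) => u v.
move: u%:R v%:R (Finv y n) (y n.+1) => {}u {}v s t u0 v0.
by field; rewrite u0 v0.
Qed.

Lemma FhatK x : Finv (Fhat x) = x.
Proof.
apply/funext; elim=> [|n IH]; first by rewrite Finv0 /= divr1 mul1r.
rewrite FinvS IH /Fhat.
move: (fibr_neq0 n.+1) (fibr_neq0 n.+2); move: (fib n.+1) (fib n.+2) => u v.
move: u%:R v%:R (x n) (x n.+1) => {}u {}v s t u0 v0.
by field; rewrite u0 v0.
Qed.

(** Truncation at [m] of the series defining a row of [abar]; it is supported below [m], so its
    pairings are finite sums. *)
Definition abar_part a m : R^nat := fun k => \sum_(k <= j < m) fibw j k * a j.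

Lemma abar_part_eq0 a m k : (m <= k)%N -> abar_part a m k = 0.
Proof. by move=> mk; rewrite /abar_part big_geq. Qed.

(** The double sum over [k <= j < m] is taken in the other order. *)
Lemma sum_Finv a y m : \sum_(0 <= j < m) a j * Finv y j =
  \sum_(0 <= k < m) abar_part a m k * y k.
Proof.
elim: m => [|m IH]; first by rewrite !big_geq.
rewrite [LHS]big_nat_recr//= IH.
rewrite [RHS](eq_big_nat _ _ (F2 := fun k => abar_part a m k * y k + a m * (fibw m k * y k))); last first.
  move=> k /andP[_ km]; rewrite /abar_part big_nat_recr//= mulrDl; congr (_ + _).
  by rewrite [RHS]mulrCA mulrA.
rewrite big_split/= -mulr_sumr -/(Finv y m) big_nat_recr//=.
by rewrite abar_part_eq0// mul0r addr0.
Qed.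

(** * A single row of the associated matrix *)

Section Row.
Variables (p q : R) (a : R^nat).
Hypotheses (p0 : 0 < p) (q0 : 0 < q) (pq : p^-1 + q^-1 = 1).
Hypothesis ha : forall y M, lp_le p y M -> cvgn (series (fun j => a j * Finv y j)).

(** For [a = A n] this is [abar A n] by unfolding. *)
Let b : R^nat := fun k => limn (abar_part a ^~ k).

Lemma dot_abar_part m y :
  dot (abar_part a m) y = series (fun j => a j * Finv y j) m.
Proof.
rewrite /series/= sum_Finv /dot.
under eq_fun do rewrite mulrC; rewrite -/(dot y (abar_part a m)).
rewrite (@dot_finsuppE _ m); last by move=> k; exact: abar_part_eq0.
by apply: eq_bigr => k _; rewrite mulrC.
Qed.

(** Entry [k] of the truncations is the sequence of partial sums of the row at the preimage under
    [Fhat] of the [k]-th unit vector, so [ha] applies. *)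
Lemma cvg_abar_part k : abar_part a ^~ k @ \oo --> b k.
Proof.
suff: cvgn (abar_part a ^~ k) by [].
pose e : R^nat := fun j => (j == k)%:R.
rewrite (_ : abar_part a ^~ k = series (fun j => a j * Finv e j)).
  by have [M eM] := lp_le_delta p0 k; exact: ha eM.
by apply/funext => m; rewrite -dot_abar_part dot_delta.
Qed.

(** For each [y] the pairings are partial sums of a convergent series, hence bounded, and uniform
    boundedness applies. *)
Lemma lp_le_abar_part : exists K, forall m, lp_le q (abar_part a m) K.
Proof.
apply: (lp_uniform_boundedness p0 q0 pq) => [m|y M yM].
  exists (pnorm q m (abar_part a m)); apply: lp_le_finsupp => // k.
  exact: abar_part_eq0.
have [C [_ hC]] := cvg_seq_bounded (ha yM).
(* Boundedness is available only for constants strictly above [C]. *)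
exists (C + 1) => m; rewrite dot_abar_part; apply: (hC (C + 1)) => //.
by rewrite ltrDl.
Qed.

Lemma lp_le_abar : exists K, lp_le q b K.
Proof.
have [K hK] := lp_le_abar_part; exists K.
have qp : q^-1 + p^-1 = 1 by rewrite addrC.
apply: (lp_le_cvg q0 p0 qp cvg_abar_part); exact: nearW.
Qed.

Lemma dot_abar y M : lp_le p y M -> limn (series (fun j => a j * Finv y j)) = dot b y.
Proof.
move=> yM; have [K hK] := lp_le_abar_part; have [L hL] := lp_le_abar.
apply: cvg_lim => //.
have := cvg_dot p0 q0 pq cvg_abar_part (K := Num.max K L) _ _ yM.
have -> : (fun j => dot (abar_part a j) y) = series (fun j => a j * Finv y j).
  by apply/funext => m; rewrite dot_abar_part.
apply.
  by move=> j; apply: le_lp_le (hK j); rewrite le_max lexx.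
by apply: le_lp_le hL; rewrite le_max lexx orbT.
Qed.

End Row.
End FibonacciMatrix.

(** * The extended-real norm in terms of prefix norms *)

Section LnormPrefix.
Variables (R : realType) (p : R).
Hypothesis p0 : 0 < p.
Implicit Types y : R^nat.

Lemma lnorm_leP y (K : R) : 0 <= K -> (lnorm p y <= K%:E)%E <-> lp_le p y K.
Proof.
move=> K0; rewrite lnormE//.
have E m : (\sum_(0 <= k < m) `|(y k)%:E| `^ p)%E = (psum p m y)%:E.
  by rewrite /psum -sumEFin.
have S0 : forall n, (0 <= n)%N -> true -> (0 <= `|(y n)%:E| `^ p)%E by move=> *; exact: poweR_ge0.
have V0 : 0 <= p^-1 by rewrite invr_ge0 ltW.
split=> [h m|h].
  rewrite -lee_fin; apply: le_trans h; rewrite /pnorm -poweR_EFin.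
  apply: gt0_ler_poweR => //.
  - by rewrite in_itv /= leey andbT lee_fin psum_ge0.
  - by rewrite in_itv /= leey andbT; apply: nneseries_ge0.
  - by rewrite -E; apply: nneseries_lim_ge.
rewrite -[K](@powRK _ p) ?gt_eqF// -poweR_EFin; apply: gt0_ler_poweR => //.
- by rewrite in_itv /= leey andbT; apply: nneseries_ge0.
- by rewrite in_itv /= leey andbT lee_fin powR_ge0.
- apply: lime_le; first exact: is_cvg_nneseries.
  apply: nearW => m; rewrite E lee_fin -pnorm_powR ?gt_eqF//.
  by apply: ge0_ler_powR; rewrite ?nnegrE ?pnorm_ge0// ltW.
Qed.

Lemma lnorm_ge0 y : (0 <= lnorm p y)%E.
Proof. by rewrite lnormE// poweR_ge0. Qed.

Lemma lnorm_ltyP y : (lnorm p y < +oo)%E <-> exists M, lp_le p y M.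
Proof.
split=> [h|[M hM]].
  have f : lnorm p y \is a fin_num by rewrite ge0_fin_numE// lnorm_ge0.
  by exists (fine (lnorm p y)); apply/lnorm_leP; rewrite ?fine_ge0 ?lnorm_ge0// fineK.
by apply: le_lt_trans (ltry M); apply/lnorm_leP => //; exact: lp_le_ge0 hM.
Qed.

Lemma lnorm_finsupp m y : (forall k, (m <= k)%N -> y k = 0) ->
  lnorm p y = (pnorm p m y)%:E.
Proof.
move=> ys; apply/eqP; rewrite eq_le; apply/andP; split.
  by apply/lnorm_leP; [exact: pnorm_ge0|exact: lp_le_finsupp].
have : (lnorm p y < +oo)%E by apply/lnorm_ltyP; exists (pnorm p m y); exact: lp_le_finsupp.
rewrite -ge0_fin_numE ?lnorm_ge0// => /fineK <-; rewrite lee_fin.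
suff : lp_le p y (fine (lnorm p y)) by exact.
apply/lnorm_leP; rewrite ?fine_ge0 ?lnorm_ge0// fineK// ge0_fin_numE ?lnorm_ge0//.
by apply/lnorm_ltyP; exists (pnorm p m y); exact: lp_le_finsupp.
Qed.

End LnormPrefix.

(** * Finite nets and the measure of noncompactness *)

Section Limsup.
Variable R : realType.
Implicit Types u : (\bar R)^nat.

Lemma limn_esup_lt_near u (x : \bar R) :
  (limn_esup u < x)%E -> \forall n \near \oo, (u n < x)%E.
Proof.
move=> /ereal_inf_lt[_ [V Voo <-] Vx]; apply: filterS Voo => n Vn.
by apply: le_lt_trans Vx; apply: ereal_sup_ubound; exists n.
Qed.

Lemma near_limn_esup_le u (x : \bar R) :
  (\forall n \near \oo, (u n <= x)%E) -> (limn_esup u <= x)%E.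
Proof.
move=> H; apply: (@le_trans _ _ (ereal_sup (u @` [set n | (u n <= x)%E]))).
  by apply: ereal_inf_lbound; exists [set n | (u n <= x)%E].
by apply: ge_ereal_sup => _ [n /= ? <-].
Qed.

End Limsup.

Section Nets.
Variable R : realType.
Implicit Types (z c : R^nat) (Y : seqSpace R).

Lemma supnorm_leP z (K : R) : (supnorm z <= K%:E)%E <-> forall n, `|z n| <= K.
Proof.
split=> [h n|h].
  by rewrite -lee_fin; apply: le_trans h; apply: ereal_sup_ubound; exists n.
by apply: ge_ereal_sup => _ [n _ <-]; rewrite lee_fin.
Qed.

(* Rounding to multiples of [d], the limit value being stored at index [N]. *)
Lemma finite_net (C d : R) (N : nat) : 0 <= C -> 0 < d ->
  exists m (c : 'I_m -> R^nat), forall z (l : R),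
    `|l| <= C -> (forall n, (n < N)%N -> `|z n| <= C) ->
    exists i, [/\ forall n, (n < N)%N -> `|z n - c i n| <= d,
      forall n, (N <= n)%N -> `|l - c i n| <= d,
      forall n, (N <= n)%N -> c i n = c i N & l = 0 -> c i N = 0].
Proof.
(* The multiples of [d] from [- B d] to [B d] cover [[-C, C]], giving [2 B + 1] grid values. *)
move=> C0 d0; pose B := Num.bound (C / d).
have BC : C / d < B%:R by apply: archi_boundP; rewrite divr_ge0// ltW.
pose F := {ffun 'I_N.+1 -> 'I_(B + B).+1}.
pose ctr (f : F) : R^nat := fun n => d * ((f (inord (minn n N)))%:R - B%:R).
exists #|F|, (fun i => ctr (enum_val i)) => z l lC zC.
pose g (t : R) : 'I_(B + B).+1 := inord (Num.truncn (t / d + B%:R)).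
have gP t : `|t| <= C -> `|t - d * ((g t)%:R - B%:R)| <= d.
  rewrite ler_norml => /andP[t1 t2].
  have u1 : - B%:R <= t / d.
    rewrite lerNl -mulNr; apply: le_trans (ltW BC); rewrite ler_pM2r ?invr_gt0//; lra.
  have u2 : t / d < B%:R by apply: le_lt_trans BC; rewrite ler_pM2r ?invr_gt0//.
  have u0 : 0 <= t / d + B%:R by lra.
  have /andP[v1 v2] := truncn_itv u0.
  rewrite /g inordK; last first.
    by rewrite ltnS ltnW// truncn_lt_nat// natrD; lra.
  have tE : t = d * (t / d) by rewrite mulrC divfK// gt_eqF.
  rewrite {1}tE -mulrBr normrM (gtr0_norm d0) ler_piMr ?(ltW d0)//.
  move: v1 v2; rewrite -natr1; move: (t / d) (Num.truncn _)%:R => s w v1 v2.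
  by rewrite ler_norml; apply/andP; split; lra.
(* Zero is itself a grid point, so limit 0 yields an eventually null centre, as [c0] requires. *)
have g0 : d * ((g 0)%:R - B%:R) = 0.
  rewrite /g mul0r add0r natrK inordK; last by rewrite ltnS leq_addr.
  by rewrite subrr mulr0.
pose f : F := [ffun i : 'I_N.+1 => if (i < N)%N then g (z i) else g l].
have fE n : ctr f n = d * ((if (n < N)%N then g (z n) else g l)%:R - B%:R).
  rewrite /ctr ffunE inordK; last by rewrite ltnS geq_minr.
  have [nN|] := boolP (n < N)%N; first by rewrite (minn_idPl (ltnW nN)) nN.
  by rewrite -leqNgt => /minn_idPr ->; rewrite ltnn.
exists (enum_rank f); rewrite enum_rankK; split.
- by move=> n nN; rewrite fE nN; apply: gP; exact: zC.
- by move=> n Nn; rewrite fE ltnNge Nn; exact: gP.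
- by move=> n Nn; rewrite !fE ltnn ltnNge Nn.
- by move=> l0; rewrite fE ltnn l0.
Qed.

(** Beyond [N] the points of [Q] are [e]-close to a constant, so a grid of mesh [(r - e) / 2] leaves
    a total error of at most [e + (r - e) / 2 < r]. *)
Lemma sball_cover Y (Q : set (R^nat)) (C e r : R) (N : nat) :
  snorm Y = @supnorm R -> carrier Y (fun=> 0) -> 0 <= C -> 0 <= e -> e < r ->
  (forall z, Q z -> carrier Y z /\ exists l, [/\ `|l| <= C,
     forall n, (n < N)%N -> `|z n| <= C,
     forall n, (N <= n)%N -> `|z n - l| <= e &
     forall c, (forall n, (N <= n)%N -> c n = c N) -> (l = 0 -> c N = 0) ->
       carrier Y c]) ->
  exists m (c : 'I_m -> R^nat), (forall i, carrier Y (c i)) /\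
    Q `<=` \bigcup_(i in [set: 'I_m]) sball Y (c i) r.
Proof.
move=> Ysup Y0 C0 e0 er QP; have d0 : 0 < (r - e) / 2 by lra.
have [m [c cP]] := finite_net N C0 d0.
(* Grid sequences outside [Y] are replaced by 0 so that every centre lies in [Y]; the one selected
   for a given [z] is in [Y] already. *)
exists m, (fun i => if `[< carrier Y (c i) >] then c i else (fun=> 0)); split.
  by move=> i; case: asboolP.
move=> z Qz; have [Yz [l [lC zC zl Yc]]] := QP z Qz.
have [i [c1 c2 c3 c4]] := cP z l lC zC.
exists i => //; rewrite asboolT; last exact: Yc.
split => //; rewrite Ysup; apply: (@le_lt_trans _ _ (e + (r - e) / 2)%:E); last first.
  by rewrite lte_fin; lra.
apply/supnorm_leP => n; have [nN|Nn] := ltnP n N.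
  by apply: le_trans (c1 n nN) _; lra.
have -> : z n - c i n = (z n - l) + (l - c i n) by rewrite addrA subrK.
by apply: le_trans (ler_normD _ _) _; apply: lerD; [exact: zl|exact: c2].
Qed.

Lemma hmn_ge0 Y (Q : set (R^nat)) : (0 <= hmn Y Q)%E.
Proof.
by apply: le_ereal_inf_tmp => _ [e [e0 _] <-]; rewrite lee_fin ltW.
Qed.

Lemma hmn_le_cover Y (Q : set (R^nat)) (r e : R) m (c : 'I_m -> R^nat) :
  0 < r -> r < e -> (forall i, carrier Y (c i)) ->
  Q `<=` \bigcup_(i in [set: 'I_m]) sball Y (c i) r -> (hmn Y Q <= e%:E)%E.
Proof.
move=> r0 re cY Qc; apply: ereal_inf_lbound; exists e => //; split.
  exact: lt_trans re.
by exists m, c, (fun=> r); split => // i; rewrite r0 re.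
Qed.

Lemma stotally_bounded_hmn_le0 Y (Q : set (R^nat)) :
  stotally_bounded Y Q -> (hmn Y Q <= 0)%E.
Proof.
move=> tb; apply/lee_addgt0Pr => e e0; rewrite add0e.
have e20 : 0 < e / 2 by lra.
have [m [c [cY Qc]]] := tb _ e20.
by apply: hmn_le_cover cY Qc => //; lra.
Qed.

End Nets.

(** * Operators given by rows in [l_q] *)

Lemma cvg_sum_seq (R : realType) (I : Type) (s : seq I) (f : I -> R^nat) (l : I -> R) :
  (forall i, f i @ \oo --> l i) ->
  (fun n => \sum_(i <- s) f i n) @ \oo --> \sum_(i <- s) l i.
Proof.
move=> fl; elim: s => [|i s IH].
  by rewrite big_nil; under eq_fun do rewrite big_nil; exact: cvg_cst.
by rewrite big_cons; under eq_fun do rewrite big_cons; exact: cvgD.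
Qed.

Section RowOperator.
Variables (R : realType) (p q : R).
Hypotheses (p0 : 0 < p) (q0 : 0 < q) (pq : p^-1 + q^-1 = 1).
Implicit Types (y c : R^nat).

Lemma lp_le_dotE (e : R) (b : R^nat) :
  (forall m y, (forall k, (m <= k)%N -> y k = 0) -> lnorm p y = 1%E ->
    `|dot b y| <= e) -> lp_le q b e.
Proof.
move=> be; have qp : q^-1 + p^-1 = 1 by rewrite addrC.
apply: (le_lp_dual q0 p0 qp) => m u us u1.
rewrite -(dot_finsuppE _ us); apply: le_trans (ler_norm _) (be m _ us _).
by rewrite (lnorm_finsupp p0 us) u1.
Qed.

Variables (D : R^nat -> R^nat) (b : nat -> R^nat) (al : R^nat) (Y : seqSpace R).
Hypothesis Ysup : snorm Y = @supnorm R.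
(** The common form of the three cases: [al = 0] for [ell_inf] and [c0], [al = alphabar A] for
    [c]. *)
Hypothesis DE : forall y M n, lp_le p y M -> D y n = dot al y + dot (b n) y.

Let unit_sphere : set (R^nat) := [set y | lnorm p y = 1%E].

(** By Hoelder the first [N] coordinates and [dot al y] are bounded on the ball of radius [M], while
    beyond [N] the image is within [M * e] of [dot al y]. *)
Lemma row_cover (M e r : R) : carrier Y (fun=> 0) ->
  (forall y, lp_le p y M -> carrier Y (D y)) ->
  (forall y N c, lp_le p y M -> (forall n, (N <= n)%N -> c n = c N) ->
     (dot al y = 0 -> c N = 0) -> carrier Y c) ->
  (exists K, lp_le q al K) -> (forall n, exists K, lp_le q (b n) K) ->
  0 <= M -> M * e < r -> (\forall n \near \oo, lp_le q (b n) e) ->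
  exists m (c : 'I_m -> R^nat), (forall i, carrier Y (c i)) /\
    D @` [set y | lp_le p y M] `<=` \bigcup_(i in [set: 'I_m]) sball Y (c i) r.
Proof.
move=> Y0 DY Yc [Ka alK] bK M0 er [N _ NP].
have e0 : 0 <= e by apply: lp_le_ge0 (NP N _); rewrite /=.
have [K KP] := choice bK.
pose S := \sum_(i < N) `|K i|.
have KS n : (n < N)%N -> K n <= S.
  move=> nN; rewrite /S (bigD1 (Ordinal nN))//=.
  by apply: le_trans (ler_norm _) _; rewrite lerDl sumr_ge0.
have S0 : 0 <= S by apply: sumr_ge0.
have Ka0 := lp_le_ge0 alK.
apply: (@sball_cover _ Y _ ((Ka + S) * M) (M * e) r N) => //.
- by rewrite mulr_ge0// addr_ge0.
- by rewrite mulr_ge0.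
- move=> _ [y yM <-]; split; first exact: DY.
  exists (dot al y); split.
  + apply: le_trans (norm_dot_le p0 q0 pq alK yM) _.
    by rewrite ler_wpM2r// lerDl.
  + move=> n nN; rewrite (DE n yM) mulrDl; apply: le_trans (ler_normD _ _) _.
    apply: lerD; first exact: (norm_dot_le p0 q0 pq alK yM).
    apply: le_trans (norm_dot_le p0 q0 pq (KP n) yM) _.
    by rewrite ler_wpM2r// KS.
  + move=> n Nn; rewrite (DE n yM) addrC addKr mulrC.
    exact: (norm_dot_le p0 q0 pq (NP n Nn) yM).
  + by move=> c; exact: Yc yM.
Qed.

(** With limsup [t], the rows are eventually bounded by [t + e/3], so balls of radius [t + e/2]
    suffice and the measure is at most [t + e]; the fractions of [e] supply the strict
    inequalities. *)
Lemma row_hmn_le : carrier Y (fun=> 0) ->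
  (forall y, lp_le p y 1 -> carrier Y (D y)) ->
  (forall y N c, lp_le p y 1 -> (forall n, (N <= n)%N -> c n = c N) ->
     (dot al y = 0 -> c N = 0) -> carrier Y c) ->
  (exists K, lp_le q al K) -> (forall n, exists K, lp_le q (b n) K) ->
  (hmn Y (D @` unit_sphere) <= limn_esup (fun n => lnorm q (b n)))%E.
Proof.
move=> Y0 DY Yc alK bK; set T := (X in limn_esup X).
have : (0 <= limn_esup T)%E.
  apply: limf_esup_ge0 => // n; exact: lnorm_ge0.
case E : (limn_esup T) => [t| |]// t0; last by rewrite leey.
rewrite lee_fin in t0; apply/lee_addgt0Pr => e e0.
have nT : \forall n \near \oo, lp_le q (b n) (t + e / 3).
  have : (limn_esup T < (t + e / 3)%:E)%E by rewrite E lte_fin; lra.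
  move=> /limn_esup_lt_near; apply: filterS => n /ltW.
  by move=> /lnorm_leP; apply => //; lra.
have er : 1 * (t + e / 3) < t + e / 2 by lra.
have [m [c [cY Qc]]] := row_cover Y0 DY Yc alK bK ler01 er nT.
apply: (@hmn_le_cover _ Y _ (t + e / 2) _ m c) => //; [lra|lra|].
apply: subset_trans Qc; apply: image_subset => y /= y1.
by apply/lnorm_leP => //; rewrite y1.
Qed.

(** [kappa] measures the control of [dot al y - l] by the radius: it is 1 for [c0], where both terms
    vanish, and 2 for [c]. *)
Lemma row_hmn_ge (kappa : R) : 1 <= kappa ->
  (forall c, carrier Y c -> exists l : R, c @ \oo --> l /\
     forall N y r, (forall k, (N <= k)%N -> y k = 0) ->
       (forall n, `|D y n - c n| <= r) -> `|dot al y - l| <= (kappa - 1) * r) ->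
  ((kappa^-1)%:E * limn_esup (fun n => lnorm q (b n)) <= hmn Y (D @` unit_sphere))%E.
Proof.
move=> k1 Yl; have kp : 0 < kappa by lra.
apply: le_ereal_inf_tmp => _ [e [e0 [m [c [r [cr Qc]]]]] <-].
rewrite lee_pdivrMl//.
have [l lP] := choice (fun i => Yl (c i) (cr i).1).
(* As there are finitely many centres, one [n] serves all of them, whichever ball contains the test
   vector's image. *)
have eta0 : (fun n => \sum_(i < m) `|c i n - l i|) @ \oo --> (0 : R).
  rewrite -[X in _ --> X](_ : \sum_(i < m) `|l i - l i| = 0 :> R); last first.
    by rewrite big1// => i _; rewrite subrr normr0.
  apply: (cvg_sum_seq _ (f := fun i n => `|c i n - l i|)) => i.
  by apply: cvg_norm; apply: cvgB; [exact: (lP i).1|exact: cvg_cst].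
apply/lee_addgt0Pr => d d0; apply: near_limn_esup_le.
have /cvgrPdist_le/(_ _ d0) := eta0; apply: filterS => n.
rewrite sub0r normrN ger0_norm ?sumr_ge0// => etad.
rewrite -EFinM -EFinD; apply/(lnorm_leP q0).
  by rewrite addr_ge0 ?mulr_ge0// ltW.
apply: lp_le_dotE => N y ys y1.
have [i _ [_]] : (\bigcup_(i in [set: 'I_m]) sball Y (c i) (r i)) (D y).
  by apply: Qc; exists y.
rewrite Ysup => /ltW /supnorm_leP Dc.
have h3 := (lP i).2 N y (r i) ys Dc.
have -> : dot (b n) y = (D y n - c i n) + (c i n - l i) - (dot al y - l i).
  by rewrite (DE n (lp_le_finsupp p0 ys)); ring.
apply: le_trans (ler_normB _ _) _.
apply: le_trans (lerD (ler_normD _ _) (lexx _)) _.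
have h1 := Dc n.
have h2 : `|c i n - l i| <= d.
  by apply: le_trans etad; rewrite (bigD1 i)//= lerDl sumr_ge0.
have [_ /andP[_ re]] := cr i.
have h4 : kappa * r i <= kappa * e by rewrite ler_pM2l// ltW.
by lra.
Qed.

Lemma limn_esup_lnorm_le0_cvg : (limn_esup (fun n => lnorm q (b n)) <= 0)%E ->
  (fun n => lnorm q (b n)) @ \oo --> 0%E.
Proof. by move=> h; apply: limn_esup_le_cvg => // n; exact: lnorm_ge0. Qed.

End RowOperator.

(** * Transfer from [l_p] to its Fibonacci domain *)

Section FibonacciOperator.
Variables (R : realType) (p q : R) (A : nat -> R^nat) (Y : seqSpace R).
Hypotheses (p0 : 0 < p) (q0 : 0 < q) (pq : p^-1 + q^-1 = 1).
Hypothesis YA : matclass (ellF p) Y A.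
Implicit Types (x y : R^nat).

Let D y : R^nat := fun n => dot (abar A n) y.

Lemma ellF_Finv y M : lp_le p y M -> carrier (ellF p) (Finv y).
Proof. by move=> yM; rewrite /= FinvK; apply/lnorm_ltyP => //; exists M. Qed.

Lemma cvg_row_Finv n y M : lp_le p y M -> cvgn (series (fun j => A n j * Finv y j)).
Proof. by move=> yM; have [h _] := YA (ellF_Finv yM); exact: h. Qed.

Lemma lp_le_abar_row n : exists K, lp_le q (abar A n) K.
Proof. exact: (lp_le_abar p0 q0 pq (@cvg_row_Finv n)). Qed.

Lemma mxact_Finv y M : lp_le p y M -> mxact A (Finv y) = D y.
Proof.
move=> yM; apply/funext => n.
exact: (dot_abar p0 q0 pq (@cvg_row_Finv n) yM).
Qed.

Lemma carrier_abar y M : lp_le p y M -> carrier Y (D y).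
Proof. by move=> yM; rewrite -(mxact_Finv yM); exact: (YA (ellF_Finv yM)).2. Qed.

(** [Fhat] is an isometric bijection onto [l_p] with inverse [Finv], so unit spheres correspond. *)
Lemma image_usphere :
  mxact A @` usphere (ellF p) = D @` [set y | lnorm p y = 1%E].
Proof.
apply/seteqP; split=> [_ [x [xF x1] <-]|_ [y y1 <-]].
  have [M yM] : exists M, lp_le p (Fhat x) M by apply/lnorm_ltyP.
  by exists (Fhat x) => //; rewrite -(mxact_Finv yM) FhatK.
have yM : lp_le p y 1 by apply/(lnorm_leP p0) => //; rewrite y1.
exists (Finv y); last exact: mxact_Finv yM.
by split; [exact: ellF_Finv yM|rewrite /= FinvK].
Qed.

Lemma compact_op_abar :
  (forall M e, 0 <= M -> 0 < e -> exists m (c : 'I_m -> R^nat),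
    (forall i, carrier Y (c i)) /\
    D @` [set y | lp_le p y M] `<=` \bigcup_(i in [set: 'I_m]) sball Y (c i) e) ->
  compact_op (ellF p) Y (mxact A).
Proof.
move=> H Q QF [M QM] e e0.
(* The constant in [sbounded] may be negative, whereas radii must not be. *)
have M0 : 0 <= Num.max M 0 by rewrite le_max lexx orbT.
have [m [c [cY Hc]]] := H _ _ M0 e0.
exists m, c; split => // _ [x Qx <-]; apply: Hc.
have xM : lp_le p (Fhat x) (Num.max M 0).
  apply/(lnorm_leP p0) => //; apply: le_trans (QM x Qx) _.
  by rewrite lee_fin le_max lexx.
by exists (Fhat x) => //; rewrite -(mxact_Finv xM) FhatK.
Qed.

Lemma compact_op_hmn_le0 : compact_op (ellF p) Y (mxact A) ->
  (op_hmn (ellF p) Y (mxact A) <= 0)%E.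
Proof.
move=> c; apply: stotally_bounded_hmn_le0; apply: c.
  by move=> x [].
by exists 1 => x [_ ->].
Qed.

Variables (b : nat -> R^nat) (al : R^nat).
Hypothesis Ysup : snorm Y = @supnorm R.
Hypothesis Y0 : carrier Y (fun=> 0).
(** Supplies the centres of the nets: eventually constant sequences lie in [ell_inf] and [c]; for
    [c0], [al = 0] makes the last premise force an eventually null sequence. *)
Hypothesis Yc : forall y M N c, lp_le p y M -> (forall n, (N <= n)%N -> c n = c N) ->
  (dot al y = 0 -> c N = 0) -> carrier Y c.
Hypothesis DE : forall y M n, lp_le p y M -> D y n = dot al y + dot (b n) y.
Hypothesis alK : exists K, lp_le q al K.
Hypothesis bK : forall n, exists K, lp_le q (b n) K.

Lemma op_hmn_le :
  (op_hmn (ellF p) Y (mxact A) <= limn_esup (fun n => lnorm q (b n)))%E.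
Proof.
rewrite /op_hmn image_usphere; apply: (row_hmn_le p0 q0 pq Ysup DE) => //.
- by move=> y; exact: carrier_abar.
- by move=> y N c; exact: Yc.
Qed.

Lemma cvg0_compact_op : (fun n => lnorm q (b n)) @ \oo --> 0%E ->
  compact_op (ellF p) Y (mxact A).
Proof.
move=> b0; apply: compact_op_abar => M e M0 e0.
(* This row bound times [M] is strictly below [e], also when [M = 0]. *)
apply: (row_cover p0 q0 pq Ysup DE (e := e / (M + 1) / 2)) => //.
- by move=> y; exact: carrier_abar.
- by move=> y N c; exact: Yc.
- have Me : 0 <= M * e by rewrite mulr_ge0// ltW.
  by rewrite !mulrA ltr_pdivrMr ?ltr_pdivrMr//; lra.
- have [_ ls] := cvg_limn_einf_sup b0.
  have : (limn_esup (fun n => lnorm q (b n)) < (e / (M + 1) / 2)%:E)%E.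
    by rewrite ls lte_fin !divr_gt0//; lra.
  move=> /limn_esup_lt_near; apply: filterS => n /ltW.
  by move=> /(lnorm_leP q0); apply; rewrite !divr_ge0//; lra.
Qed.

Lemma op_hmn_ge (kappa : R) : 1 <= kappa ->
  (forall c, carrier Y c -> exists l : R, c @ \oo --> l /\
     forall N y r, (forall k, (N <= k)%N -> y k = 0) ->
       (forall n, `|D y n - c n| <= r) -> `|dot al y - l| <= (kappa - 1) * r) ->
  ((kappa^-1)%:E * limn_esup (fun n => lnorm q (b n))
    <= op_hmn (ellF p) Y (mxact A))%E.
Proof.
by move=> k1 H; rewrite /op_hmn image_usphere; exact: (row_hmn_ge p0 q0 pq Ysup DE).
Qed.

(** Compactness makes the measure vanish, hence also the limsup; the row norms being nonnegative,
    they tend to 0. *)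
Lemma compact_op_cvg0 (kappa : R) : 0 < kappa ->
  ((kappa^-1)%:E * limn_esup (fun n => lnorm q (b n))
    <= op_hmn (ellF p) Y (mxact A))%E ->
  compact_op (ellF p) Y (mxact A) -> (fun n => lnorm q (b n)) @ \oo --> 0%E.
Proof.
move=> k0 h /compact_op_hmn_le0/(le_trans h); rewrite lee_pdivrMl// mule0.
exact: limn_esup_lnorm_le0_cvg.
Qed.

End FibonacciOperator.

(** * The associated matrix of a matrix into [c] *)

Section Cases.
Variables (R : realType) (p q : R) (A : nat -> R^nat).
Hypotheses (p0 : 0 < p) (q0 : 0 < q) (pq : p^-1 + q^-1 = 1).
Implicit Types (y c : R^nat).

Lemma eventually_cst_cvg c N : (forall n, (N <= n)%N -> c n = c N) ->
  c @ \oo --> c N.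
Proof. by move=> cN; apply: cvg_near_cst; exists N. Qed.

Lemma bounded_cvgn c : cvgn c -> carrier ell_inf c.
Proof. exact: cvg_seq_bounded. Qed.

Lemma dot0l y : dot (fun=> 0) y = 0.
Proof.
rewrite /dot (_ : series _ = fun=> 0) ?lim_cst//.
by apply/funext => n; rewrite /series/= big1// => k _; rewrite mul0r.
Qed.

Section Convergent.
Hypothesis YA : matclass (ellF p) cspace A.

(** Column [k] is the image of the [k]-th unit vector of [l_p], which lies in [c]. *)
Lemma cvg_abar k : cvgn (fun n => abar A n k).
Proof.
pose e : R^nat := fun j => (j == k)%:R.
rewrite (_ : (fun n => abar A n k) = fun n => dot (abar A n) e).
  by have [M eM] := lp_le_delta p0 k; exact: (carrier_abar p0 q0 pq YA eM).
by apply/funext => n; rewrite dot_delta.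
Qed.

(** A second use of uniform boundedness, now over the rows: convergent images are bounded. It puts
    the limit row [alphabar A] in [l_q]. *)
Lemma lp_le_abar_unif : exists K, forall n, lp_le q (abar A n) K.
Proof.
apply: (lp_uniform_boundedness p0 q0 pq) => [n|y M yM].
  exact: (lp_le_abar_row p0 q0 pq YA n).
have [C [_ hC]] := cvg_seq_bounded (carrier_abar p0 q0 pq YA yM).
by exists (C + 1) => n; apply: (hC (C + 1)) => //; rewrite ltrDl.
Qed.

Lemma lp_le_alphabar : exists K, lp_le q (alphabar A) K.
Proof.
have [K hK] := lp_le_abar_unif; exists K.
have qp : q^-1 + p^-1 = 1 by rewrite addrC.
by apply: (lp_le_cvg q0 p0 qp cvg_abar); exact: nearW.
Qed.

Lemma cvg_dot_abar_finsupp N y : (forall k, (N <= k)%N -> y k = 0) ->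
  (fun n => dot (abar A n) y) @ \oo --> dot (alphabar A) y.
Proof.
move=> ys; rewrite (dot_finsuppE _ ys).
under eq_fun do rewrite (dot_finsuppE _ ys).
by apply: (@cvg_prefix_sum _ (abar A) (alphabar A)) => k; exact: cvg_abar.
Qed.

End Convergent.
End Cases.
Unset Implicit Arguments.

(** * The three target spaces *)

Local Open Scope ereal_scope.

Theorem theorem3p2 (R : realType) (p q : R) (A : nat -> R^nat)
    (hp : (1 < p)%R) (hq : q = (p / (p - 1))%R) :
  (matclass (ellF p) ell_inf A ->
     (0 <= op_hmn (ellF p) ell_inf (mxact A)
        <= limn_esup (fun n => (\sum_(k <oo) `|(abar A n k)%:E| `^ q) `^ q^-1))
     /\ ((fun n => (\sum_(k <oo) `|(abar A n k)%:E| `^ q) `^ q^-1) @ \oo --> 0 ->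
         compact_op (ellF p) ell_inf (mxact A)))
  /\
  (matclass (ellF p) c0space A ->
     op_hmn (ellF p) c0space (mxact A)
       = limn_esup (fun n => (\sum_(k <oo) `|(abar A n k)%:E| `^ q) `^ q^-1)
     /\ (compact_op (ellF p) c0space (mxact A) <->
         (fun n => (\sum_(k <oo) `|(abar A n k)%:E| `^ q) `^ q^-1) @ \oo --> 0))
  /\
  (matclass (ellF p) cspace A ->
     (forall k, cvgn (fun n => abar A n k))
     /\ ((2^-1)%:E * limn_esup (fun n =>
           (\sum_(k <oo) `|(abar A n k - alphabar A k)%:E| `^ q) `^ q^-1)
         <= op_hmn (ellF p) cspace (mxact A)
         <= limn_esup (fun n =>
           (\sum_(k <oo) `|(abar A n k - alphabar A k)%:E| `^ q) `^ q^-1))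
     /\ (compact_op (ellF p) cspace (mxact A) <->
         (fun n => (\sum_(k <oo) `|(abar A n k - alphabar A k)%:E| `^ q) `^ q^-1)
           @ \oo --> 0)).
Proof.
have p0 : (0 < p)%R by lra.
have p10 : (0 < p - 1)%R by lra.
have q0 : (0 < q)%R by rewrite hq divr_gt0.
have pq : (p^-1 + q^-1 = 1)%R.
  by rewrite hq; field; rewrite !gt_eqF.
have TE : (fun n => (\sum_(k <oo) `|(abar A n k)%:E| `^ q) `^ q^-1) =
    (fun n => lnorm q (abar A n)) by apply/funext => n; rewrite lnormE.
have UE : (fun n => (\sum_(k <oo) `|(abar A n k - alphabar A k)%:E| `^ q) `^ q^-1) =
    (fun n => lnorm q (fun k => abar A n k - alphabar A k)%R).
  by apply/funext => n; rewrite lnormE.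
have zero_cvg : (fun=> 0%R : R) @ \oo --> (0%R : R) by exact: cvg_cst.
have DE0 y M n : lp_le p y M ->
    dot (abar A n) y = (dot (fun=> 0) y + dot (abar A n) y)%R.
  by move=> _; rewrite dot0l add0r.
have al0 : exists K, lp_le q (fun=> 0%R) K by exists 0%R; exact: lp_le0.
rewrite TE UE; split; [|split] => YA.
- have bK := lp_le_abar_row p0 q0 pq YA.
  have Y0 : carrier (@ell_inf R) (fun=> 0%R) by apply: bounded_cvgn; apply/cvg_ex; exists 0%R.
  have Yc y M N c : lp_le p y M -> (forall n, (N <= n)%N -> c n = c N) ->
      (dot (fun=> 0%R) y = 0%R -> c N = 0%R) -> carrier (@ell_inf R) c.
    move=> _ cN _; apply: bounded_cvgn; apply/cvg_ex; exists (c N).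
    exact: eventually_cst_cvg.
  split; first by rewrite hmn_ge0 (op_hmn_le p0 q0 pq YA erefl Y0 Yc DE0 al0 bK).
  exact: (cvg0_compact_op p0 q0 pq YA erefl Y0 Yc DE0 al0 bK).
- have bK := lp_le_abar_row p0 q0 pq YA.
  have Yc y M N c : lp_le p y M -> (forall n, (N <= n)%N -> c n = c N) ->
      (dot (fun=> 0%R) y = 0%R -> c N = 0%R) -> carrier (@c0space R) c.
    move=> _ cN c0; rewrite /= -(c0 (dot0l y)).
    exact: eventually_cst_cvg.
  (* Centres in [c0] have limit 0 and [al = 0], so [kappa = 1] and the lower bound meets the upper
     one. *)
  have lower := op_hmn_ge p0 q0 pq YA (Y := c0space) erefl DE0 (lexx 1%R).
  have {}lower : (1^-1)%:E * limn_esup (fun n => lnorm q (abar A n)) <=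
      op_hmn (ellF p) c0space (mxact A).
    apply: lower => c c0; exists 0%R; split => // N y r ys _.
    by rewrite dot0l subrr normr0 subrr mul0r.
  split.
    apply/eqP; rewrite eq_le (op_hmn_le p0 q0 pq YA erefl zero_cvg Yc DE0 al0 bK) /=.
    by move: lower; rewrite invr1 mul1e.
  split; first exact: (compact_op_cvg0 q0 ltr01 lower).
  exact: (cvg0_compact_op p0 q0 pq YA erefl zero_cvg Yc DE0 al0 bK).
- have ca := cvg_abar p0 q0 pq YA; split => //.
  have alK := lp_le_alphabar p0 q0 pq YA.
  have [Ka alKa] := alK.
  have bK0 := lp_le_abar_row p0 q0 pq YA.
  have qp : (q^-1 + p^-1 = 1)%R by rewrite addrC.
  have bK n : exists K, lp_le q (fun k => abar A n k - alphabar A k)%R K.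
    have [K aK] := bK0 n; exists (K + Ka)%R; exact: (lp_leB q0 p0 qp aK alKa).
  have DE y M n : lp_le p y M -> dot (abar A n) y =
      (dot (alphabar A) y + dot (fun k => abar A n k - alphabar A k) y)%R.
    move=> yM; have [K aK] := bK0 n.
    by rewrite (dotBl p0 q0 pq aK alKa yM) addrC subrK.
  have Y0 : carrier (@cspace R) (fun=> 0%R) by apply/cvg_ex; exists 0%R.
  have Yc y M N c : lp_le p y M -> (forall n, (N <= n)%N -> c n = c N) ->
      (dot (alphabar A) y = 0%R -> c N = 0%R) -> carrier (@cspace R) c.
    by move=> _ cN _; apply/cvg_ex; exists (c N); exact: eventually_cst_cvg.
  have lower : (2^-1)%:E * limn_esup (fun n => lnorm q (fun k => abar A n k - alphabar A k)%R) <=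
      op_hmn (ellF p) cspace (mxact A).
    apply: (op_hmn_ge p0 q0 pq YA erefl DE); first by lra.
    (* With [kappa = 2]: letting [n] tend to infinity in [|D y n - c n| <= r] bounds the limit
       difference by [r], which is the source of the factor one half. *)
    move=> c cc; exists (limn c); split => // N y r ys Dc.
    rewrite (_ : 2 - 1 = 1 :> R)%R; last by lra.
    rewrite mul1r.
    have Dl : `|dot (abar A n) y - c n|%R @[n --> \oo] -->
        `|dot (alphabar A) y - limn c|%R.
      by apply: cvg_norm; apply: cvgB; [exact: (cvg_dot_abar_finsupp p0 q0 pq YA ys)|exact: cc].
    by apply: (cvgr_to_le Dl); exact: nearW.
  split; first by rewrite lower (op_hmn_le p0 q0 pq YA erefl Y0 Yc DE alK bK).
  split; first by apply: (compact_op_cvg0 q0 _ lower); lra.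
  exact: (cvg0_compact_op p0 q0 pq YA erefl Y0 Yc DE alK bK).
Qed.
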